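(* The reduced two-body system has no trajectories leading to antipodal singularities; that is, there is no solution $(m_1,m_2,m_3,q,p):[0,t^* )\to\mathbb{R}^3\times(0,\pi)\times\mathbb{R}$, with $t^*\in(0,+\infty]$, such that $q(t)\to\pi$ as $t\to t^*$.
   Context: The reduced two-body system on $S^2$ (two identical bodies of mass $1$, potential $V(q)=-\cot q$, where $q\in(0,\pi)$ is the angle between the position vectors $\mathbf{q}_1,\mathbf{q}_2$) is the following system of ODEs for $(m_1,m_2,m_3,q,p)\in\mathbb{R}^3\times(0,\pi)\times\mathbb{R}$: $$\dot m_1=\cot(q)\,(-m_2^2+m_3^2+2m_2m_3\cot q),\quad \dot m_2=m_1m_2\cot q-m_3(-2m_1+p+2m_1\csc^2 q),\quad \dot m_3=m_2p-m_1m_3\cot q,$$ $$\dot q=2p-m_1,\qquad \dot p=-\csc^2(q)\,(1+m_2m_3-2m_3^2\cot q).$$ It has the conserved quantities $\mathcal{C}=m_1^2+m_2^2+m_3^2$ (the Casimir function) and, with $\xi=\cot q$, $\mathcal{H}=\frac12\left(m_1^2+m_2^2-2m_1p+2p^2+\xi(-2-2m_2m_3+m_3^2\xi)+m_3^2(1+\xi^2)\right)$ (the Hamiltonian). A trajectory leads to an antipodal singularity if $\mathbf{q}_1(t)+\mathbf{q}_2(t)\to0$, which in the reduced variables means $q(t)\to\pi$. *)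

(* Defs.v *)
From Stdlib Require Import Reals.
From Coquelicot Require Import Coquelicot.
Open Scope R_scope.

Definition cot (x : R) : R := cos x / sin x.
Definition csc (x : R) : R := / sin x.

Definition time_domain (T : Rbar) (t : R) : Prop := 0 <= t /\ Rbar_lt t T.

(* The values of the functions outside [0, T) are irrelevant: [D_in] is the
   derivative relative to [0, T), hence one-sided at t = 0. *)
Definition reduced_solution (T : Rbar) (m1 m2 m3 q p : R -> R) : Prop :=
  forall t : R, time_domain T t ->
    0 < q t < PI /\
    D_in m1 (fun s => cot (q s) *
        (- m2 s ^ 2 + m3 s ^ 2 + 2 * m2 s * m3 s * cot (q s)))
      (time_domain T) t /\
    D_in m2 (fun s => m1 s * m2 s * cot (q s)
        - m3 s * (- 2 * m1 s + p s + 2 * m1 s * csc (q s) ^ 2))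
      (time_domain T) t /\
    D_in m3 (fun s => m2 s * p s - m1 s * m3 s * cot (q s))
      (time_domain T) t /\
    D_in q (fun s => 2 * p s - m1 s)
      (time_domain T) t /\
    D_in p (fun s => - csc (q s) ^ 2 *
        (1 + m2 s * m3 s - 2 * m3 s ^ 2 * cot (q s)))
      (time_domain T) t.

(* q(t) -> PI as t -> T from the left, for T finite or +oo. *)
Definition leads_to_antipodal_singularity (T : Rbar) (q : R -> R) : Prop :=
  filterlim q (within (fun t : R => Rbar_lt t T) (Rbar_locally T)) (locally PI).

(* Main.v *)
Require Import Defs.
From Stdlib Require Import Reals Lra.
From Coquelicot Require Import Coquelicot.
Open Scope R_scope.

(** The Hamiltonian is a sum of squares plus the potential [- cot q], hence
    [- cot (q t)] is at most the conserved energy. At an antipodal singularity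
    [- cot (q t)] would tend to [+oo]. *)

(** Conservation ([hamiltonian_derive]) fixes the energy at its value [h] at some interior time
    [t0], and [cot_hamiltonian_ge] then gives [- cot (q t) <= h] at every later time. Multiplied by
    [sin (q t) > 0], this reads [h * sin (q t) + cos (q t) >= 0]. The left side is continuous in [q]
    and equals [-1] at [PI], so [q] cannot come arbitrarily close to [PI]. The argument is the same
    for finite and infinite [T]. *)

Definition hamiltonian (m1 m2 m3 q p : R) : R :=
  / 2 * (m1 ^ 2 + m2 ^ 2 - 2 * m1 * p + 2 * p ^ 2
         + cot q * (- 2 - 2 * m2 * m3 + m3 ^ 2 * cot q)
         + m3 ^ 2 * (1 + cot q ^ 2)).

Lemma cot_hamiltonian_ge (m1 m2 m3 q p : R) :
  - cot q <= hamiltonian m1 m2 m3 q p.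
Proof.
  unfold hamiltonian.
  (* Twice the difference of the two sides is exactly the sum of these five squares. *)
  assert (H1 := pow2_ge_0 (m1 - p)). assert (H2 := pow2_ge_0 p).
  assert (H3 := pow2_ge_0 (m2 - cot q * m3)).
  assert (H4 := pow2_ge_0 m3). assert (H5 := pow2_ge_0 (m3 * cot q)).
  nra.
Qed.

(** Makes the equations of motion polynomial in [cot], so that conservation of energy reduces to a
    [ring] identity. *)
Lemma csc_sqr (x : R) : sin x <> 0 -> csc x ^ 2 = 1 + cot x ^ 2.
Proof.
  intros Hx. unfold csc, cot.
  assert (H := sin2_cos2 x). unfold Rsqr in H.
  transitivity ((sin x * sin x + cos x * cos x) / sin x ^ 2).
  - rewrite H. now field.
  - now field.
Qed.

Lemma is_derive_cot (x : R) :
  sin x <> 0 -> is_derive cot x (- (1 + cot x ^ 2)).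
Proof.
  intros Hx. unfold cot. auto_derive; [easy|]. now field.
Qed.

(** At an interior point of [D], small increments stay in [D], so the relative derivative is an
    ordinary two-sided one. *)
Lemma is_derive_D_in (f d : R -> R) (D : R -> Prop) (x : R) :
  locally x D -> D_in f d D x -> is_derive f x (d x).
Proof.
  intros [del Hdel] HD. apply is_derive_Reals. intros eps Heps.
  destruct (HD eps Heps) as [a [Ha HDa]].
  assert (Hm : 0 < Rmin a del).
  { apply Rmin_pos; [exact Ha | apply cond_pos]. }
  exists (mkposreal _ Hm). intros h Hh0 Hh. simpl in Hh.
  assert (Hha : Rabs h < a) by (eapply Rlt_le_trans; [exact Hh | apply Rmin_l]).
  assert (Hhd : Rabs h < del) by (eapply Rlt_le_trans; [exact Hh | apply Rmin_r]).
  specialize (HDa (x + h)). simpl in HDa. unfold Rdist in HDa.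
  replace (x + h - x) with h in HDa by ring.
  apply HDa. split; [split | exact Hha].
  - apply Hdel. change (Rabs (x + h - x) < del).
    now replace (x + h - x) with h by ring.
  - lra.
Qed.

Lemma time_domain_locally (T : Rbar) (t : R) :
  0 < t -> Rbar_lt t T -> locally t (time_domain T).
Proof.
  intros H0 HT.
  apply (filter_imp (fun s => 0 < s /\ Rbar_lt s T)).
  - intros s [Hs HsT]. split; [lra | exact HsT].
  - apply filter_and.
    + exact (open_gt 0 t H0).
    + exact (open_Rbar_lt' t T HT).
Qed.

(** Turns a limit at [T] into one concrete late time: a midpoint close below a finite [T], or a
    point past the threshold when [T] is infinite. *)
Lemma within_Rbar_locally_lt_ex (T : Rbar) (a : R) (P : R -> Prop) :
  Rbar_lt a T -> within (fun t : R => Rbar_lt t T) (Rbar_locally T) P ->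
  exists t : R, a < t /\ Rbar_lt t T /\ P t.
Proof.
  destruct T as [r| |]; simpl; intros HaT HP.
  - destruct HP as [del Hdel].
    assert (Hd := cond_pos del).
    assert (Hl := Rmax_l a (r - del)). assert (Hr := Rmax_r a (r - del)).
    assert (Hm : Rmax a (r - del) < r) by (apply Rmax_lub_lt; lra).
    exists ((Rmax a (r - del) + r) / 2).
    repeat split; [lra | lra |].
    apply Hdel; [|lra].
    change (Rabs ((Rmax a (r - del) + r) / 2 - r) < del).
    apply Rabs_def1; lra.
  - destruct HP as [M HM].
    assert (Hl := Rmax_l a M). assert (Hr := Rmax_r a M).
    exists (Rmax a M + 1). repeat split; [lra |].
    apply HM; [lra | exact I].
  - contradiction.
Qed.

Lemma hamiltonian_derive (T : Rbar) (m1 m2 m3 q p : R -> R) (t : R) :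
  reduced_solution T m1 m2 m3 q p -> 0 < t -> Rbar_lt t T ->
  is_derive (fun s => hamiltonian (m1 s) (m2 s) (m3 s) (q s) (p s)) t 0.
Proof.
  intros Hsol H0 HT.
  assert (Hloc := time_domain_locally T t H0 HT).
  destruct (Hsol t (conj (Rlt_le _ _ H0) HT)) as [Hq [D1 [D2 [D3 [Dq Dp]]]]].
  apply is_derive_D_in in D1, D2, D3, Dq, Dp; try exact Hloc.
  assert (Hs : sin (q t) <> 0) by (apply Rgt_not_eq, sin_gt_0; apply Hq).
  rewrite (csc_sqr _ Hs) in D2, Dp.
  assert (Dc := is_derive_comp cot q t _ _ (is_derive_cot _ Hs) Dq).
  (* With a name of its own, [cot (q s)] is for [auto_derive] a single unknown function, whose
     derivative [Dc] supplies. *)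
  set (c := fun s => cot (q s)) in Dc.
  apply (is_derive_ext (fun s => / 2 * (m1 s ^ 2 + m2 s ^ 2 - 2 * m1 s * p s
    + 2 * p s ^ 2 + c s * (- 2 - 2 * m2 s * m3 s + m3 s ^ 2 * c s)
    + m3 s ^ 2 * (1 + c s ^ 2)))); [reflexivity|].
  auto_derive.
  - repeat split; eexists; eassumption.
  (* Eta-contraction, so that the remaining [Derive] terms match the equations of motion. *)
  - change (fun x => m1 x) with m1. change (fun x => m2 x) with m2.
    change (fun x => m3 x) with m3. change (fun x => p x) with p.
    change (fun x => c x) with c.
    rewrite (is_derive_unique _ _ _ D1), (is_derive_unique _ _ _ D2),
      (is_derive_unique _ _ _ D3), (is_derive_unique _ _ _ Dp),
      (is_derive_unique c _ _ Dc).
    unfold c, scal; simpl; unfold mult; simpl. ring.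
Qed.

Theorem lemma3p2 :
  ~ exists (T : Rbar) (m1 m2 m3 q p : R -> R),
      Rbar_lt 0 T /\
      reduced_solution T m1 m2 m3 q p /\
      leads_to_antipodal_singularity T q.
Proof.
  intros [T [m1 [m2 [m3 [q [p [HT [Hsol Hlim]]]]]]]].
  (* Starting from an interior time avoids the one-sided derivative at 0. *)
  destruct (within_Rbar_locally_lt_ex T 0 (fun _ => True) HT) as [t0 [Ht0 [Ht0T _]]].
  { now apply filter_forall. }
  set (H := fun s => hamiltonian (m1 s) (m2 s) (m3 s) (q s) (p s)).
  (* The bound is used in the form multiplied by [sin], which has no pole at [PI]. *)
  assert (Hnear : locally PI (fun x => H t0 * sin x + cos x < 0)).
  { assert (Hc : continuous (fun x => H t0 * sin x + cos x) PI).
    { apply (ex_derive_continuous (fun x => H t0 * sin x + cos x)).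
      now auto_derive. }
    apply (Hc (fun y => y < 0)). apply (open_lt 0). rewrite sin_PI, cos_PI. lra. }
  destruct (within_Rbar_locally_lt_ex T t0 _ Ht0T (Hlim _ Hnear))
    as [t [Ht [HtT Hneg]]].
  assert (Hconst : H t0 = H t).
  { apply (eq_is_derive H t0 t); [|exact Ht].
    intros s Hs. apply (hamiltonian_derive T); [exact Hsol | lra |].
    apply (Rbar_le_lt_trans s t T); [apply Hs | exact HtT]. }
  destruct (Hsol t) as [Hq _]; [split; [lra | exact HtT]|].
  assert (Hs : 0 < sin (q t)) by (apply sin_gt_0; apply Hq).
  assert (Hge := cot_hamiltonian_ge (m1 t) (m2 t) (m3 t) (q t) (p t)).
  fold (H t) in Hge. rewrite <- Hconst in Hge.
  assert (Hcos : cos (q t) = cot (q t) * sin (q t)).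
  { unfold cot. field. lra. }
  (* [Hneg] now says that [(H t0 + cot (q t)) * sin (q t)] is negative, while [Hge] and [Hs] make
     both factors nonnegative. *)
  rewrite Hcos in Hneg. nra.
Qed.
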